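(* Let $\Omega\subset\mathbb{R}$ be an open interval, let $M,A,P,T$ be positive constants, and let $u:\Omega\times[0,T]\to\mathbb{R}$ be an $H_2$ solution of $$u_t=a(u_x,u,x,t)u_{xx},$$ where $a>0$ and $$a(p,q,x,t)\,p^2\ge A\quad\text{for all }|p|\ge P\text{ and all }q,x,t.$$ If $\operatorname{osc}_{\Omega\times[0,T]}u\le M$, then for each $x\in\Omega$ there are $T'>0$, $C_1$ and $C_2$, depending only on $A$, $P$, $M$ and $\operatorname{dist}(x,\partial\Omega)$, such that for $0<t<T'$ (with $t\le T$) $$|u_x(x,t)|\le C_1\sqrt{t}\,(1+t)\exp\!\left(\frac{C_2}{t}\right).$$
   Context: $\operatorname{osc}f=\sup f-\inf f$. Solutions are understood in the classical sense. For an integer $k\ge0$ and $\alpha\in(0,1]$, $H_{k+\alpha}(Q)$ is the parabolic Hölder space of functions with finite norm $\sum_{|\beta|+2j\le k}\sup|D^\beta_xD^j_tu|+\sum_{|\beta|+2j=k}[D_x^\beta D_t^ju]_{\alpha,\alpha/2}$, where $[w]_{\alpha,\alpha/2}=\sup_{(x_1,t_1)\neq(x_2,t_2)}|w(x_1,t_1)-w(x_2,t_2)|/(|x_1-x_2|+|t_1-t_2|^{1/2})^\alpha$; $H_2$ is the case $k+\alpha=2$. *)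

(* Defs.v *)
From Stdlib Require Import Reals List PeanoNat.
From Coquelicot Require Import Coquelicot.
Import ListNotations.
Open Scope R_scope.

Definition is_open_interval (Om : R -> Prop) : Prop :=
  exists l r : Rbar, Rbar_lt l r /\
    forall x : R, Om x <-> Rbar_lt l x /\ Rbar_lt x r.

Definition boundary (E : R -> Prop) (y : R) : Prop :=
  forall eps : posreal,
    (exists z, ball y eps z /\ E z) /\ (exists z, ball y eps z /\ ~ E z).

(** Equal to [p_infty] when the boundary is empty, that is for the whole line. *)
Definition dist_boundary (E : R -> Prop) (x : R) : Rbar :=
  Glb_Rbar (fun r => exists y, boundary E y /\ r = Rabs (x - y)).

(** Functions on a cylinder are total functions [R -> R -> R] of [x] and [t],
    of which only the values on the cylinder are used. *)
Definition cylinder (Om : R -> Prop) (T : R) (x t : R) : Prop :=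
  Om x /\ 0 <= t <= T.

Definition sup_on (Q : R -> R -> Prop) (f : R -> R -> R) : Rbar :=
  Lub_Rbar (fun r => exists x t, Q x t /\ r = f x t).

Definition inf_on (Q : R -> R -> Prop) (f : R -> R -> R) : Rbar :=
  Glb_Rbar (fun r => exists x t, Q x t /\ r = f x t).

Definition osc (Q : R -> R -> Prop) (f : R -> R -> R) : Rbar :=
  Rbar_minus (sup_on Q f) (inf_on Q f).

(** Derivative relative to [E]: one-sided at an endpoint of an interval [E], so
    that values outside [E] play no role. *)
Definition is_derive_within (E : R -> Prop) (f : R -> R) (t l : R) : Prop :=
  filterlim (fun s => (f s - f t) / (s - t)) (within E (locally' t)) (locally l).

Definition is_dt (T : R) (u : R -> R -> R) (x t l : R) : Prop :=
  is_derive_within (fun s => 0 <= s <= T) (fun s => u x s) t l.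

Definition is_dx (u : R -> R -> R) (x t l : R) : Prop :=
  is_derive (fun y => u y t) x l.

Definition dx (u : R -> R -> R) (x t : R) : R := Derive (fun y => u y t) x.

Definition holder_seminorm (Q : R -> R -> Prop) (alpha : R) (w : R -> R -> R)
  : Rbar :=
  Lub_Rbar (fun r => exists x1 t1 x2 t2,
    Q x1 t1 /\ Q x2 t2 /\ (x1, t1) <> (x2, t2) /\
    r = Rabs (w x1 t1 - w x2 t2)
        / Rpower (Rabs (x1 - x2) + sqrt (Rabs (t1 - t2))) alpha).

(** [D b j] is the derivative of [u] taken [j] times in [t], then [b] times in
    [x]. *)
Definition parabolic_derivatives (Om : R -> Prop) (T : R) (k : nat)
  (u : R -> R -> R) (D : nat -> nat -> R -> R -> R) : Prop :=
  (forall x t, cylinder Om T x t -> D 0%nat 0%nat x t = u x t) /\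
  (forall j x t, (2 * S j <= k)%nat -> cylinder Om T x t ->
     is_dt T (D 0%nat j) x t (D 0%nat (S j) x t)) /\
  (forall b j x t, (S b + 2 * j <= k)%nat -> cylinder Om T x t ->
     is_dx (D b j) x t (D (S b) j x t)).

Definition Rbar_sum (l : list Rbar) : Rbar :=
  fold_right Rbar_plus (Finite 0) l.

Definition parabolic_indices (p : nat -> bool) (k : nat) : list (nat * nat) :=
  filter (fun bj => p (fst bj + 2 * snd bj)%nat)
    (list_prod (seq 0 (S k)) (seq 0 (S k))).

Definition holder_norm (Q : R -> R -> Prop) (k : nat) (alpha : R)
  (D : nat -> nat -> R -> R -> R) : Rbar :=
  Rbar_plus
    (Rbar_sum (map
       (fun bj => sup_on Q (fun x t => Rabs (D (fst bj) (snd bj) x t)))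
       (parabolic_indices (fun n => Nat.leb n k) k)))
    (Rbar_sum (map
       (fun bj => holder_seminorm Q alpha (D (fst bj) (snd bj)))
       (parabolic_indices (fun n => Nat.eqb n k) k))).

Definition in_H (Om : R -> Prop) (T : R) (k : nat) (alpha : R)
  (u : R -> R -> R) : Prop :=
  exists D, parabolic_derivatives Om T k u D /\
    is_finite (holder_norm (cylinder Om T) k alpha D).

(** As [alpha] lies in (0,1], the order 2 is [k = 1] and [alpha = 1]. *)
Definition in_H2 (Om : R -> Prop) (T : R) (u : R -> R -> R) : Prop :=
  in_H Om T 1 1 u.

(** The equation holds pointwise on [Om] x (0,T]; nothing is asked of the
    derivatives [u_t] and [u_xx] beyond their existence. *)
Definition classical_solution (Om : R -> Prop) (T : R)
  (a : R -> R -> R -> R -> R) (u : R -> R -> R) : Prop :=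
  forall x t, Om x -> 0 < t <= T ->
    ex_derive (fun y => u y t) x /\
    exists ut uxx, is_dt T u x t ut /\ is_dx (dx u) x t uxx /\
      ut = a (dx u x t) (u x t) x t * uxx.

(* Main.v *)
Require Import Defs.
From Stdlib Require Import Reals Lra IndefiniteDescription.
From Coquelicot Require Import Coquelicot.
Open Scope R_scope.

(** Doubling of variables. With [G = 2 b M] and [b = 3 M / A], the function
    [phi s t = (t / b) ln (1 + s exp (G / t))] is concave in [s], satisfies
    [phi_ss = - (b / t) phi_s ^ 2], vanishes at [s = 0], and for each [s > 0] is
    at least [M] for small [t]. One compares [u y t - u x t] with
    [phi (y - x + k (x - x0) ^ 2 + k (y - x0) ^ 2) t] on [x0 - r <= x <= y <= x0 + r].
    Where this barrier is below [M] it is so steep, for small [t], that the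
    quadratic corrections cost at most half of the concavity and its slopes exceed
    [P]; at an interior touching point the structure condition then gives
    [- (b / 2 t) A] from each variable, that is [- 3 M / t] in total, whereas the
    barrier decreases in time at rate at most [G / (b t) = 2 M / t]. The (non
    quantitative) Lipschitz bound of [u] starts the comparison at a small positive
    time. The slope of the barrier at [x = y = x0] is [(t / b) exp (G / t)]. *)

(** * Attained maxima on a triangle times a time interval *)

Definition clamp (a b x : R) : R := Rmax a (Rmin b x).

Lemma clamp_in (a b x : R) : a <= b -> a <= clamp a b x <= b.
Proof.
intros H; unfold clamp, Rmax, Rmin; destruct (Rle_dec b x); destruct (Rle_dec a _); lra.
Qed.

Lemma clamp_id (a b x : R) : a <= x <= b -> clamp a b x = x.
Proof.
intros H; unfold clamp, Rmax, Rmin; destruct (Rle_dec b x); destruct (Rle_dec a _); lra.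
Qed.

(** Composition with the 1-Lipschitz retraction [clamp] extends functions from an interval to the
    whole line, where [continuity] is a global notion. *)
Lemma clamp_lipschitz (a b x y : R) : a <= b ->
  Rabs (clamp a b x - clamp a b y) <= Rabs (x - y).
Proof.
intros H; unfold clamp, Rmax, Rmin, Rabs.
repeat destruct (Rle_dec _ _); repeat destruct (Rcase_abs _); lra.
Qed.

Lemma Rmax_lipschitz (x y x' y' : R) :
  Rabs (Rmax x y - Rmax x' y') <= Rabs (x - x') + Rabs (y - y').
Proof.
unfold Rmax, Rabs.
repeat destruct (Rle_dec _ _); repeat destruct (Rcase_abs _); lra.
Qed.

(** The parameter [z] is there because maxima are taken in one variable at a time: a maximizer is
    chosen for each value of the others, with no regularity claimed for [g]. *)
Lemma continuity_argmax (X : Type) (f : X -> R -> R) (a b : R) : a <= b ->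
  (forall z, continuity (f z)) ->
  exists g : X -> R, forall z, a <= g z <= b /\
    forall c, a <= c <= b -> f z c <= f z (g z).
Proof.
intros Hab Hf.
apply (functional_choice (fun z m => a <= m <= b /\ forall c, a <= c <= b -> f z c <= f z m)).
intros z.
destruct (continuity_ab_maj (f z) a b Hab) as [m [H1 H2]].
- intros c _; apply Hf.
- exists m; split; assumption.
Qed.

Lemma lipschitz_continuity (f : R -> R) (K : R) :
  (forall x y, Rabs (f x - f y) <= K * Rabs (x - y)) -> continuity f.
Proof.
intros Hf x eps Heps.
assert (HK : 0 < Rabs K + 1) by (generalize (Rabs_pos K); lra).
exists (eps / (Rabs K + 1)); split.
- apply Rdiv_lt_0_compat; lra.
- intros y [_ Hy]; simpl in *; unfold Rdist in *.
  apply Rle_lt_trans with ((Rabs K + 1) * Rabs (y - x)).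
  + eapply Rle_trans; [apply Hf|].
    apply Rmult_le_compat_r; [apply Rabs_pos|].
    generalize (Rle_abs K); lra.
  + apply Rlt_le_trans with ((Rabs K + 1) * (eps / (Rabs K + 1))).
    * apply Rmult_lt_compat_l; assumption.
    * right; field; lra.
Qed.

(** Each maximizer competes at the other point, so the maximal value inherits the Lipschitz constant
    even though [m] may jump. This lets maximization be iterated. *)
Lemma lipschitz_max (X : Type) (f : R -> X -> R) (m : R -> X) (K : R) :
  (forall x z, f x z <= f x (m x)) ->
  (forall x x' z, Rabs (f x z - f x' z) <= K * Rabs (x - x')) ->
  forall x x', Rabs (f x (m x) - f x' (m x')) <= K * Rabs (x - x').
Proof.
intros Hm Hf x x'; apply Rabs_le; split.
- generalize (Hm x (m x')) (proj1 (Rabs_le_between _ _) (Hf x x' (m x'))); lra.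
- generalize (Hm x' (m x)) (proj1 (Rabs_le_between _ _) (Hf x x' (m x))); lra.
Qed.

(** The maximum is taken in [t], then in [y], then in [x]. Continuity suffices in time; in space the
    Lipschitz bound is uniform in [t], so that the partial maxima remain continuous. *)
Lemma triangle_cylinder_max (f : R -> R -> R -> R) (a b t0 t1 K : R) :
  a <= b -> t0 <= t1 -> 0 <= K ->
  (forall x y x' y' t, a <= x <= y -> y <= b -> a <= x' <= y' -> y' <= b ->
     t0 <= t <= t1 ->
     Rabs (f x y t - f x' y' t) <= K * (Rabs (x - x') + Rabs (y - y'))) ->
  (forall x y, a <= x <= y -> y <= b ->
     continuity (fun t => f x y (clamp t0 t1 t))) ->
  exists x y t, a <= x <= y /\ y <= b /\ t0 <= t <= t1 /\
    forall x' y' t', a <= x' <= y' -> y' <= b -> t0 <= t' <= t1 ->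
      f x' y' t' <= f x y t.
Proof.
intros Hab Ht HK Hlip Hcont.
set (cx := clamp a b).
(* The triangle is the image of the square under replacing y by max (x, y), and [clamp] extends this
   to the whole plane. The repeated dependence on x turns [K] into [2 * K]. *)
set (g := fun x y t => f (cx x) (Rmax (cx x) (cx y)) (clamp t0 t1 t)).
assert (Htri : forall x y, a <= cx x <= Rmax (cx x) (cx y) /\ Rmax (cx x) (cx y) <= b).
{ intros x y; generalize (clamp_in a b x Hab) (clamp_in a b y Hab); fold cx.
  intros; repeat split; [lra|apply Rmax_l|apply Rmax_lub; lra]. }
assert (Hg : forall x y x' y' t,
  Rabs (g x y t - g x' y' t) <= 2 * K * (Rabs (x - x') + Rabs (y - y'))).
{ intros x y x' y' t; unfold g.
  destruct (Htri x y) as [H1 H2]; destruct (Htri x' y') as [H3 H4].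
  eapply Rle_trans; [apply Hlip; auto; apply clamp_in; assumption|].
  generalize (Rmax_lipschitz (cx x) (cx y) (cx x') (cx y'))
    (clamp_lipschitz a b x x' Hab) (clamp_lipschitz a b y y' Hab); fold cx.
  intros H5 H6 H7.
  apply Rle_trans with (K * (2 * (Rabs (x - x') + Rabs (y - y')))); [|right; ring].
  apply Rmult_le_compat_l; [assumption|].
  generalize (Rabs_pos (y - y')); lra. }
destruct (continuity_argmax (R * R) (fun z t => g (fst z) (snd z) t) t0 t1 Ht)
  as [mt Hmt].
{ intros [x y]; destruct (Htri x y); apply Hcont; assumption. }
assert (Hmax : forall x y t, g x y t <= g x y (mt (x, y))).
{ intros x y t; destruct (Hmt (x, y)) as [_ H]; simpl in H.
  apply Rle_trans with (g x y (clamp t0 t1 t)).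
  - unfold g; rewrite (clamp_id t0 t1 (clamp t0 t1 t)) by (apply clamp_in; assumption).
    apply Rle_refl.
  - apply H; apply clamp_in; assumption. }
set (h := fun x y => g x y (mt (x, y))).
destruct (continuity_argmax R h a b Hab) as [my Hmy].
{ intros x; apply lipschitz_continuity with (2 * K).
  apply (lipschitz_max R (g x) (fun y => mt (x, y))); [apply Hmax|].
  intros y y' t; eapply Rle_trans; [apply Hg|].
  rewrite Rminus_diag, Rabs_R0; right; ring. }
assert (Hmax' : forall x y, h x y <= h x (my x)).
{ intros x y; destruct (Hmy x) as [_ H].
  apply Rle_trans with (h x (cx y)); [|apply H, clamp_in; assumption].
  eapply Rle_trans; [|apply Hmax].
  unfold h, g, cx; rewrite (clamp_id a b (clamp a b y)) by (apply clamp_in; assumption).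
  apply Rle_refl. }
destruct (continuity_ab_maj (fun x => h x (my x)) a b Hab) as [x [Hx1 Hx2]].
{ intros c _; apply lipschitz_continuity with (2 * K).
  apply lipschitz_max; [apply Hmax'|].
  intros x x' y; apply (lipschitz_max R (fun x t => g x y t) (fun x => mt (x, y)));
    [intros z t; apply Hmax|].
  intros z z' t; eapply Rle_trans; [apply Hg|].
  rewrite Rminus_diag, Rabs_R0; right; ring. }
exists (cx x), (Rmax (cx x) (cx (my x))), (clamp t0 t1 (mt (x, my x))).
destruct (Htri x (my x)) as [H1 H2].
repeat split; try lra; try (apply clamp_in; assumption).
intros x' y' t' Hx' Hy' Ht'.
replace (f x' y' t') with (g x' y' t').
{ eapply Rle_trans; [apply Hmax|].
  eapply Rle_trans; [apply Hmax'|].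
  apply Hx1; lra. }
unfold g, cx; rewrite !clamp_id by lra.
rewrite Rmax_right by lra; reflexivity.
Qed.

(** * Difference quotients, maximum tests and Lipschitz bounds *)

Lemma is_derive_within_ball (E : R -> Prop) (f : R -> R) (t l eps : R) :
  is_derive_within E f t l -> 0 < eps ->
  exists delta, 0 < delta /\ forall s, E s -> s <> t -> Rabs (s - t) < delta ->
    Rabs ((f s - f t) / (s - t) - l) < eps.
Proof.
intros Hf Heps.
destruct (Hf (fun y => Rabs (y - l) < eps)) as [delta Hd].
- exists (mkposreal _ Heps); intros y Hy; exact Hy.
- exists delta; split; [apply cond_pos|].
  intros s HE Hs Hst; apply (Hd s); auto.
Qed.

Lemma is_derive_is_derive_within (E : R -> Prop) (f : R -> R) (t l : R) :
  is_derive f t l -> is_derive_within E f t l.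
Proof.
intros Hf P [eps HP].
apply is_derive_Reals in Hf.
destruct (Hf eps (cond_pos eps)) as [delta Hd].
exists delta; intros s Hs Hst _; apply HP.
generalize (Hd (s - t)); rewrite Rplus_minus.
intros H; apply H; [|exact Hs].
intros H0; apply Hst, Rminus_diag_uniq, H0.
Qed.

(** Backward difference quotients at [t] are compared, hence an inequality and not an equality. This
    covers a maximum at the final time, where [is_dt] is one-sided. *)
Lemma last_time_max_derive (E : R -> Prop) (f g h : R -> R) (a t l m n : R) :
  a < t -> (forall s, a <= s <= t -> E s) ->
  is_derive_within E f t l -> is_derive_within E g t m -> is_derive h t n ->
  (forall s, a <= s <= t -> f s - g s - h s <= f t - g t - h t) ->
  n <= l - m.
Proof.
intros Hat HE Hf Hg Hh Hmax.
apply (is_derive_is_derive_within E) in Hh.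
apply Rnot_lt_le; intros Hlt.
assert (Heps : 0 < (n - (l - m)) / 3) by lra.
destruct (is_derive_within_ball _ _ _ _ _ Hf Heps) as [d1 [Hd1 H1]].
destruct (is_derive_within_ball _ _ _ _ _ Hg Heps) as [d2 [Hd2 H2]].
destruct (is_derive_within_ball _ _ _ _ _ Hh Heps) as [d3 [Hd3 H3]].
set (e := Rmin (t - a) (Rmin d1 (Rmin d2 d3)) / 2).
assert (He : 0 < e /\ e < t - a /\ e < d1 /\ e < d2 /\ e < d3).
{ unfold e; generalize (Rmin_l (t - a) (Rmin d1 (Rmin d2 d3)))
    (Rmin_r (t - a) (Rmin d1 (Rmin d2 d3))) (Rmin_l d1 (Rmin d2 d3))
    (Rmin_r d1 (Rmin d2 d3)) (Rmin_l d2 d3) (Rmin_r d2 d3).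
  assert (0 < Rmin (t - a) (Rmin d1 (Rmin d2 d3)))
    by (repeat apply Rmin_glb_lt; lra).
  lra. }
assert (Hse : Rabs (t - e - t) = e) by (rewrite Rabs_left; lra).
specialize (H1 (t - e)); specialize (H2 (t - e)); specialize (H3 (t - e)).
rewrite Hse in H1, H2, H3.
assert (HEe : E (t - e)) by (apply HE; lra).
assert (Hne : t - e <> t) by lra.
destruct He as [He0 [He1 [He2 [He3 He4]]]].
specialize (H1 HEe Hne He2); specialize (H2 HEe Hne He3); specialize (H3 HEe Hne He4).
apply Rabs_lt_between in H1; apply Rabs_lt_between in H2; apply Rabs_lt_between in H3.
assert (Hq : 0 <= (f (t - e) - f t) / (t - e - t) - (g (t - e) - g t) / (t - e - t)
   - (h (t - e) - h t) / (t - e - t)).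
{ replace (_ - _ - _) with
    (((f t - g t - h t) - (f (t - e) - g (t - e) - h (t - e))) / e) by (field; lra).
  apply Rdiv_le_0_compat; [|assumption].
  assert (H : a <= t - e <= t) by lra; specialize (Hmax _ H); lra. }
lra.
Qed.

Lemma is_derive_within_continuity (E : R -> Prop) (f : R -> R) (a b : R) :
  a <= b -> (forall t, a <= t <= b -> E t) ->
  (forall t, a <= t <= b -> exists l, is_derive_within E f t l) ->
  continuity (fun t => f (clamp a b t)).
Proof.
intros Hab HE Hf t eps Heps.
set (c := clamp a b t).
assert (Hc : a <= c <= b) by (apply clamp_in; assumption).
destruct (Hf c Hc) as [l Hl].
destruct (is_derive_within_ball _ _ _ _ 1 Hl Rlt_0_1) as [d [Hd H]].
assert (HK : 0 < Rabs l + 1) by (generalize (Rabs_pos l); lra).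
exists (Rmin d (eps / (Rabs l + 1))); split.
{ apply Rmin_glb_lt; [assumption|apply Rdiv_lt_0_compat; assumption]. }
intros s [_ Hs]; simpl in *; unfold Rdist in *; fold c.
assert (Hsc : Rabs (clamp a b s - c) < Rmin d (eps / (Rabs l + 1)))
  by (eapply Rle_lt_trans; [apply clamp_lipschitz; assumption|exact Hs]).
destruct (Req_dec (clamp a b s) c) as [He|Hne].
{ rewrite He, Rminus_diag, Rabs_R0; assumption. }
specialize (H (clamp a b s) (HE _ (clamp_in a b s Hab)) Hne
  (Rlt_le_trans _ _ _ Hsc (Rmin_l _ _))).
set (q := (f (clamp a b s) - f c) / (clamp a b s - c)) in *.
replace (f (clamp a b s) - f c) with (q * (clamp a b s - c))
  by (unfold q; field; lra).
rewrite Rabs_mult.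
apply Rlt_le_trans with ((Rabs l + 1) * (eps / (Rabs l + 1))); [|right; field; lra].
apply Rmult_le_0_lt_compat; try apply Rabs_pos.
- generalize (Rabs_triang (q - l) l); replace (q - l + l) with q by ring; lra.
- eapply Rlt_le_trans; [exact Hsc|apply Rmin_r].
Qed.

(** The second derivative is given at [c] only. If it were positive, [f'] would be positive just to
    the right of [c], and the mean value theorem would make [f] exceed [f c]. *)
Lemma local_max_derivatives (f f' : R -> R) (c l delta : R) : 0 < delta ->
  (forall y, Rabs (y - c) < delta -> is_derive f y (f' y)) ->
  is_derive f' c l ->
  (forall y, Rabs (y - c) < delta -> f y <= f c) ->
  f' c = 0 /\ l <= 0.
Proof.
intros Hdelta Hf Hf' Hmax.
assert (H0 : f' c = 0).
{ assert (Hc : is_derive f c (f' c)) by (apply Hf; rewrite Rminus_diag, Rabs_R0; assumption).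
  apply is_derive_Reals in Hc.
  rewrite <- (derive_pt_eq_0 f c (f' c) (exist _ (f' c) Hc) Hc).
  apply (deriv_maximum f (c - delta) (c + delta) c); try lra.
  intros y H1 H2; apply Hmax, Rabs_lt_between; lra. }
split; [exact H0|].
apply Rnot_lt_le; intros Hl.
apply is_derive_Reals in Hf'.
destruct (Hf' (l / 2)) as [d Hd]; [lra|].
set (e := Rmin d delta / 2).
assert (He : 0 < e < d /\ e < delta).
{ unfold e; generalize (Rmin_l d delta) (Rmin_r d delta) (Rmin_pos d delta (cond_pos d) Hdelta).
  lra. }
destruct (MVT_cor2 f f' c (c + e)) as [y [Heq Hy]]; [lra| |].
{ intros y Hy; apply is_derive_Reals, Hf, Rabs_lt_between; lra. }
assert (Hle : f (c + e) <= f c) by (apply Hmax, Rabs_lt_between; lra).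
assert (Hq : Rabs ((f' (c + (y - c)) - f' c) / (y - c) - l) < l / 2).
{ apply Hd; [lra|apply Rabs_lt_between; lra]. }
rewrite Rplus_minus, H0 in Hq; apply Rabs_lt_between in Hq.
assert (Hfy : 0 < f' y).
{ replace (f' y) with ((f' y - 0) / (y - c) * (y - c)) by (field; lra).
  apply Rmult_lt_0_compat; lra. }
assert (0 < f' y * (c + e - c)) by (apply Rmult_lt_0_compat; lra).
lra.
Qed.

Lemma right_min_derive (f : R -> R) (c l e : R) : 0 < e ->
  is_derive f c l -> (forall y, c <= y <= c + e -> f c <= f y) -> 0 <= l.
Proof.
intros He Hf Hmin; apply is_derive_Reals in Hf.
apply Rnot_lt_le; intros Hl.
destruct (Hf (- l)) as [d Hd]; [lra|].
set (h := Rmin d e / 2).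
assert (Hh : 0 < h < d /\ h <= e).
{ unfold h; generalize (Rmin_l d e) (Rmin_r d e) (Rmin_pos d e (cond_pos d) He).
  lra. }
assert (Hq : Rabs ((f (c + h) - f c) / h - l) < - l)
  by (apply Hd; [lra|apply Rabs_lt_between; lra]).
apply Rabs_lt_between in Hq.
assert (0 <= (f (c + h) - f c) / h).
{ apply Rdiv_le_0_compat; [|lra].
  assert (Hc : c <= c + h <= c + e) by lra; generalize (Hmin _ Hc); lra. }
lra.
Qed.

Lemma bounded_derive_lipschitz (f f' : R -> R) (a b L : R) :
  (forall c, a <= c <= b -> is_derive f c (f' c)) ->
  (forall c, a <= c <= b -> Rabs (f' c) <= L) ->
  forall x y, a <= x <= b -> a <= y <= b -> Rabs (f x - f y) <= L * Rabs (x - y).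
Proof.
intros Hf HL.
assert (H : forall x y, a <= x -> x < y -> y <= b ->
  Rabs (f x - f y) <= L * Rabs (x - y)).
{ intros x y Hx Hxy Hy.
  destruct (MVT_cor2 f f' x y Hxy) as [c [Heq Hc]].
  { intros c Hc; apply is_derive_Reals, Hf; lra. }
  rewrite Rabs_minus_sym, Heq, Rabs_mult, (Rabs_minus_sym x y).
  apply Rmult_le_compat_r; [apply Rabs_pos|apply HL; lra]. }
intros x y Hx Hy; destruct (Rtotal_order x y) as [Hxy|[Hxy|Hxy]].
- apply H; lra.
- subst; rewrite !Rminus_diag, Rabs_R0; lra.
- rewrite Rabs_minus_sym, (Rabs_minus_sym x y); apply H; lra.
Qed.

(** * The barrier, its derivatives and its size *)

(** The quadratic terms keep the gap at least [k r ^ 2] when [x = x0 - r] or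
    [y = x0 + r], even if [x] and [y] are close to each other. *)
Definition localized_gap (k x0 x y : R) : R := y - x + k * (x - x0) ^ 2 + k * (y - x0) ^ 2.

Definition barrier (b G k x0 x y t : R) : R :=
  t / b * ln (1 + localized_gap k x0 x y * exp (G / t)).

(** With F for this quantity, t / b * F is the derivative of the barrier with respect to the gap
    [w], and F' = - F ^ 2 in [w]. *)
Definition steepness (G w t : R) : R := exp (G / t) / (1 + w * exp (G / t)).

Lemma steepness_denominator (G w t : R) : 0 <= w -> 1 <= 1 + w * exp (G / t).
Proof.
intros Hw; generalize (Rmult_le_pos w _ Hw (Rlt_le _ _ (exp_pos (G / t)))); lra.
Qed.

Lemma barrier_dy (b G k x0 x y t : R) : 0 < b -> 0 <= localized_gap k x0 x y ->
  is_derive (fun z => barrier b G k x0 x z t) y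
    (t / b * ((1 + 2 * k * (y - x0)) * steepness G (localized_gap k x0 x y) t)).
Proof.
intros Hb Hw; generalize (steepness_denominator G _ t Hw).
unfold barrier, steepness, localized_gap; intros H; auto_derive; [lra|].
field; repeat split; lra.
Qed.

Lemma barrier_dx (b G k x0 x y t : R) : 0 < b -> 0 <= localized_gap k x0 x y ->
  is_derive (fun z => barrier b G k x0 z y t) x
    (- (t / b * ((1 - 2 * k * (x - x0)) * steepness G (localized_gap k x0 x y) t))).
Proof.
intros Hb Hw; generalize (steepness_denominator G _ t Hw).
unfold barrier, steepness, localized_gap; intros H; auto_derive; [lra|].
field; repeat split; lra.
Qed.

(** The term in 2 k is the curvature of the gap; the square comes from F' = - F ^ 2 for the
    steepness and is the concavity exploited later. *)
Lemma barrier_dyy (b G k x0 x y t : R) : 0 < b -> 0 <= localized_gap k x0 x y ->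
  is_derive
    (fun z => t / b * ((1 + 2 * k * (z - x0)) * steepness G (localized_gap k x0 x z) t)) y
    (t / b * (2 * k * steepness G (localized_gap k x0 x y) t
      - ((1 + 2 * k * (y - x0)) * steepness G (localized_gap k x0 x y) t) ^ 2)).
Proof.
intros Hb Hw; generalize (steepness_denominator G _ t Hw).
unfold steepness, localized_gap; intros H; auto_derive; [lra|].
field; repeat split; lra.
Qed.

Lemma barrier_dxx (b G k x0 x y t : R) : 0 < b -> 0 <= localized_gap k x0 x y ->
  is_derive
    (fun z => - (t / b * ((1 - 2 * k * (z - x0)) * steepness G (localized_gap k x0 z y) t))) x
    (t / b * (2 * k * steepness G (localized_gap k x0 x y) t
      - ((1 - 2 * k * (x - x0)) * steepness G (localized_gap k x0 x y) t) ^ 2)).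
Proof.
intros Hb Hw; generalize (steepness_denominator G _ t Hw).
unfold steepness, localized_gap; intros H; auto_derive; [lra|].
field; repeat split; lra.
Qed.

Lemma barrier_dt (b G k x0 x y t : R) : 0 < b -> 0 < t -> 0 <= localized_gap k x0 x y ->
  is_derive (fun s => barrier b G k x0 x y s) t
    (1 / b * ln (1 + localized_gap k x0 x y * exp (G / t))
      - G / (b * t) * (localized_gap k x0 x y * steepness G (localized_gap k x0 x y) t)).
Proof.
intros Hb Ht Hw; generalize (steepness_denominator G _ t Hw).
unfold barrier, steepness; generalize (localized_gap k x0 x y); intros w H.
auto_derive; unfold Rdiv in *; [lra|].
field; repeat split; lra.
Qed.

Lemma ln_le_minus_1 (x : R) : 0 < x -> ln x <= x - 1.
Proof.
intros Hx; generalize (exp_ineq1_le (ln x)); rewrite exp_ln by assumption; lra.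
Qed.

Lemma ln_ge_0 (x : R) : 1 <= x -> 0 <= ln x.
Proof.
intros Hx; rewrite <- ln_1; apply ln_le; lra.
Qed.

Lemma barrier_ge_0 (b G k x0 x y t : R) : 0 < b -> 0 < t -> 0 <= localized_gap k x0 x y ->
  0 <= barrier b G k x0 x y t.
Proof.
intros Hb Ht Hw; apply Rmult_le_pos.
- apply Rlt_le, Rdiv_lt_0_compat; assumption.
- apply ln_ge_0, steepness_denominator; assumption.
Qed.

(** The logarithm is nonnegative and [w * steepness G w t] is at most 1, so the rate of decrease is
    bounded uniformly in the gap. *)
Lemma barrier_dt_lower (b G w t : R) : 0 < b -> 0 < t -> 0 <= G -> 0 <= w ->
  - (G / (b * t)) <= 1 / b * ln (1 + w * exp (G / t)) - G / (b * t) * (w * steepness G w t).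
Proof.
intros Hb Ht HG Hw; generalize (steepness_denominator G w t Hw); intros HD.
assert (0 <= 1 / b * ln (1 + w * exp (G / t))).
{ apply Rmult_le_pos; [apply Rlt_le, Rdiv_lt_0_compat; lra|apply ln_ge_0; assumption]. }
assert (HG' : 0 <= G / (b * t)).
{ apply Rdiv_le_0_compat; [assumption|apply Rmult_lt_0_compat; assumption]. }
assert (H1 : w * steepness G w t <= 1).
{ unfold steepness; apply Rmult_le_reg_r with (1 + w * exp (G / t)); [lra|].
  field_simplify; lra. }
generalize (Rmult_le_compat_l _ _ _ HG' H1); lra.
Qed.

(** A concave function vanishing at 0 is at least its argument times its slope there; here this is
    ln D >= 1 - 1 / D with D the denominator. It serves at the initial time. *)
Lemma barrier_ge_steepness (b G k x0 x y t : R) :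
  0 < b -> 0 < t -> 0 <= localized_gap k x0 x y ->
  t / b * (localized_gap k x0 x y * steepness G (localized_gap k x0 x y) t)
    <= barrier b G k x0 x y t.
Proof.
intros Hb Ht Hw; generalize (steepness_denominator G _ t Hw).
unfold barrier, steepness; generalize (localized_gap k x0 x y); intros w H.
apply Rmult_le_compat_l; [apply Rlt_le, Rdiv_lt_0_compat; assumption|].
set (D := 1 + w * exp (G / t)) in *.
generalize (ln_le_minus_1 (/ D) (Rinv_0_lt_compat D ltac:(lra))).
rewrite ln_Rinv by lra; intros H1.
replace (w * (exp (G / t) / D)) with (1 - / D) by (unfold D; field; fold D; lra).
lra.
Qed.

(** Where the barrier is below [M] the denominator is at most [exp (b M / t)],
    half of the exponent [G / t]. *)
Lemma steepness_lower (b M k x0 x y t : R) :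
  0 < b -> 0 < t -> 0 <= localized_gap k x0 x y ->
  barrier b (2 * b * M) k x0 x y t <= M ->
  exp (b * M / t) <= steepness (2 * b * M) (localized_gap k x0 x y) t.
Proof.
intros Hb Ht Hw; generalize (steepness_denominator (2 * b * M) _ t Hw).
unfold barrier, steepness; generalize (localized_gap k x0 x y); intros w H HM.
set (D := 1 + w * exp (2 * b * M / t)) in *.
assert (HD : D <= exp (b * M / t)).
{ apply Rnot_lt_le; intros Hlt.
  apply ln_increasing in Hlt; [|apply exp_pos]; rewrite ln_exp in Hlt.
  apply (Rmult_lt_compat_l (t / b)) in Hlt; [|apply Rdiv_lt_0_compat; lra].
  replace (t / b * (b * M / t)) with M in Hlt by (field; lra); lra. }
replace (exp (2 * b * M / t)) with (exp (b * M / t) * exp (b * M / t))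
  by (rewrite <- exp_plus; f_equal; field; lra).
apply Rmult_le_reg_r with D; [lra|].
set (E := exp (b * M / t)) in *.
replace (E * E / D * D) with (E * E) by (field; lra).
apply Rmult_le_compat_l; [apply Rlt_le, exp_pos|assumption].
Qed.

(** The square outweighs the prefactor of the slope: t / b * exp (b M / t) is still at least a
    multiple of 1 / t. *)
Lemma exp_ge_square (z : R) : 0 <= z -> (z / 2) ^ 2 <= exp z.
Proof.
intros Hz; replace (exp z) with (exp (z / 2) ^ 2).
- apply pow_incr; generalize (exp_ineq1_le (z / 2)); lra.
- simpl; rewrite Rmult_1_r, <- exp_plus; f_equal; field.
Qed.

(** With E = exp (b M / t) > b M / t, the assumption gives w E >= 1, so w E ^ 2 >= E, while t / b *
    ln E = M. This keeps touching points away from the lateral boundary. *)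
Lemma barrier_far (b M k x0 x y t : R) : 0 < b -> 0 < t -> 0 < M ->
  0 <= localized_gap k x0 x y -> t <= b * M * localized_gap k x0 x y ->
  M <= barrier b (2 * b * M) k x0 x y t.
Proof.
intros Hb Ht HM Hw Hfar.
unfold barrier; revert Hw Hfar; generalize (localized_gap k x0 x y); intros w Hw Hfar.
replace M with (t / b * (b * M / t)) at 1 by (field; lra).
apply Rmult_le_compat_l; [apply Rlt_le, Rdiv_lt_0_compat; assumption|].
rewrite <- (ln_exp (b * M / t)); apply ln_le; [apply exp_pos|].
replace (exp (2 * b * M / t)) with (exp (b * M / t) * exp (b * M / t))
  by (rewrite <- exp_plus; f_equal; field; lra).
set (E := exp (b * M / t)).
assert (HE : b * M / t < E).
{ generalize (exp_ineq1_le (b * M / t)); fold E; lra. }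
assert (H : 1 <= w * E).
{ apply Rle_trans with (w * (b * M / t)).
  - replace (w * (b * M / t)) with (b * M * w / t) by (field; lra).
    apply Rmult_le_reg_r with t; [assumption|]; field_simplify; lra.
  - apply Rmult_le_compat_l; lra. }
assert (HE0 : 0 < E) by apply exp_pos.
generalize (Rmult_le_compat_r E _ _ (Rlt_le _ _ HE0) H); lra.
Qed.

(** From 16 k <= F comes 2 k F <= F ^ 2 / 8, and from m >= 1 / 2 comes F ^ 2 / 8 <= (m F) ^ 2 / 2,
    so half of the concavity survives. *)
Lemma barrier_concavity (b t k m F : R) : 0 < b -> 0 < t -> 0 <= k ->
  1 / 2 <= m -> 16 * k <= F ->
  t / b * (2 * k * F - (m * F) ^ 2) <= - (b / (2 * t)) * (t / b * (m * F)) ^ 2.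
Proof.
intros Hb Ht Hk Hm HF.
replace (- (b / (2 * t)) * (t / b * (m * F)) ^ 2) with (t / b * (- (m * F) ^ 2 / 2))
  by (field; lra).
apply Rmult_le_compat_l; [apply Rlt_le, Rdiv_lt_0_compat; assumption|].
assert (H1 : 1 / 4 <= m ^ 2) by nra.
assert (H2 : 1 / 4 * F ^ 2 <= m ^ 2 * F ^ 2)
  by (apply Rmult_le_compat_r; [apply pow2_ge_0|assumption]).
rewrite Rpow_mult_distr; nra.
Qed.

(** No upper bound on the coefficient [c] is available, so the barrier has to be
    concave in each variable separately. *)
Lemma diffusion_upper (A P b t c p v : R) : 0 < b -> 0 < t -> 0 < c ->
  (P <= Rabs p -> A <= c * p ^ 2) -> P <= Rabs p ->
  v <= - (b / (2 * t)) * p ^ 2 -> c * v <= - (b / (2 * t)) * A.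
Proof.
intros Hb Ht Hc HA HP Hv; specialize (HA HP).
assert (Hbt : 0 < b / (2 * t)) by (apply Rdiv_lt_0_compat; lra).
generalize (Rmult_le_compat_l _ _ _ (Rlt_le _ _ Hc) Hv)
  (Rmult_le_compat_l _ _ _ (Rlt_le _ _ Hbt) HA); lra.
Qed.

(** * Spatial Lipschitz bounds for the barrier *)

Lemma ln_1_plus_lipschitz (e w w' : R) : 0 < e -> 0 <= w -> 0 <= w' ->
  Rabs (ln (1 + w * e) - ln (1 + w' * e)) <= e * Rabs (w - w').
Proof.
intros He.
assert (H : forall u v, 0 <= u -> u <= v ->
  Rabs (ln (1 + u * e) - ln (1 + v * e)) <= e * Rabs (u - v)).
{ intros u v Hu Huv.
  assert (H1 : 0 <= u * e) by (apply Rmult_le_pos; lra).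
  assert (H2 : u * e <= v * e) by (apply Rmult_le_compat_r; lra).
  assert (H3 : ln (1 + u * e) <= ln (1 + v * e)) by (apply ln_le; lra).
  rewrite Rabs_minus_sym, Rabs_pos_eq, Rabs_minus_sym, Rabs_pos_eq by lra.
  rewrite <- ln_div by lra.
  eapply Rle_trans; [apply ln_le_minus_1, Rdiv_lt_0_compat; lra|].
  replace ((1 + v * e) / (1 + u * e) - 1) with ((e * (v - u)) / (1 + u * e))
    by (field; lra).
  apply Rmult_le_reg_r with (1 + u * e); [lra|].
  replace (e * (v - u) / (1 + u * e) * (1 + u * e)) with (e * (v - u) * 1)
    by (field; lra).
  apply Rmult_le_compat_l; [apply Rmult_le_pos; lra|lra]. }
intros Hw Hw'; destruct (Rle_dec w w') as [Hle|Hle]; [apply H; assumption|].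
rewrite Rabs_minus_sym, (Rabs_minus_sym w); apply H; lra.
Qed.

(** Only the value [c] of the coefficient at each point is recorded, which makes the class invariant
    under a change of sign of [v] without reflecting a coefficient function. *)
Definition steep_solution (A P T : R) (Om : R -> Prop) (v p : R -> R -> R) : Prop :=
  forall y s, Om y -> 0 < s <= T ->
    is_dx v y s (p y s) /\
    exists c vt vxx, 0 < c /\ (P <= Rabs (p y s) -> A <= c * p y s ^ 2) /\
      is_dt T v y s vt /\ is_dx p y s vxx /\ vt = c * vxx.

Lemma localized_gap_ge (k x0 x y : R) : 0 <= k -> y - x <= localized_gap k x0 x y.
Proof.
intros Hk; unfold localized_gap.
generalize (Rmult_le_pos _ _ Hk (pow2_ge_0 (x - x0)))
  (Rmult_le_pos _ _ Hk (pow2_ge_0 (y - x0))); lra.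
Qed.

(** Since k r = 1 / 4, each square has slope at most 1 / 2 on the window, rounded up to 1; the
    difference y - x adds 1. *)
Lemma localized_gap_lipschitz (k r x0 x y x' y' : R) : 0 < r -> k = / (4 * r) ->
  Rabs (x - x0) <= r -> Rabs (y - x0) <= r -> Rabs (x' - x0) <= r -> Rabs (y' - x0) <= r ->
  Rabs (localized_gap k x0 x y - localized_gap k x0 x' y') <= 2 * (Rabs (x - x') + Rabs (y - y')).
Proof.
intros Hr Hk.
assert (Hkr : 2 * k * r <= 1 / 2) by (rewrite Hk; right; field; lra).
assert (Hk0 : 0 < k) by (rewrite Hk; apply Rinv_0_lt_compat; lra).
assert (Hq : forall u u', Rabs (u - x0) <= r -> Rabs (u' - x0) <= r ->
  Rabs (k * (u - x0) ^ 2 - k * (u' - x0) ^ 2) <= Rabs (u - u')).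
{ intros u u' Hu Hu'.
  replace (k * (u - x0) ^ 2 - k * (u' - x0) ^ 2)
    with (k * ((u - x0) + (u' - x0)) * (u - u')) by ring.
  rewrite Rabs_mult, Rabs_mult, (Rabs_pos_eq k) by lra.
  rewrite <- (Rmult_1_l (Rabs (u - u'))) at 2.
  apply Rmult_le_compat_r; [apply Rabs_pos|].
  generalize (Rabs_triang (u - x0) (u' - x0)); intros Ht.
  apply Rle_trans with (k * (2 * r)); [|lra].
  apply Rmult_le_compat_l; lra. }
intros Hx Hy Hx' Hy'; unfold localized_gap.
replace (_ - _) with ((k * (x - x0) ^ 2 - k * (x' - x0) ^ 2)
   + (k * (y - x0) ^ 2 - k * (y' - x0) ^ 2) + (y - y') + - (x - x')) by ring.
generalize (Hq x x' Hx Hx') (Hq y y' Hy Hy'); intros H1 H2.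
eapply Rle_trans; [apply Rabs_triang|]; rewrite Rabs_Ropp.
apply Rle_trans with (Rabs (x - x') + Rabs (y - y') + Rabs (y - y') + Rabs (x - x')); [|lra].
apply Rplus_le_compat_r.
eapply Rle_trans; [apply Rabs_triang|]; apply Rplus_le_compat_r.
eapply Rle_trans; [apply Rabs_triang|]; lra.
Qed.

(** The constant degenerates as [t0] tends to 0, which is harmless: it serves the existence of a
    maximum on [t0, t1]. *)
Lemma barrier_lipschitz (b G k r x0 x y x' y' t t0 t1 : R) :
  0 < b -> 0 <= G -> 0 < r -> k = / (4 * r) -> 0 < t0 <= t -> t <= t1 ->
  x0 - r <= x <= y -> y <= x0 + r -> x0 - r <= x' <= y' -> y' <= x0 + r ->
  Rabs (barrier b G k x0 x y t - barrier b G k x0 x' y' t)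
    <= 2 * (t1 / b * exp (G / t0)) * (Rabs (x - x') + Rabs (y - y')).
Proof.
intros Hb HG Hr Hk Ht0 Ht1 Hx Hy Hx' Hy'.
assert (Hk0 : 0 < k) by (rewrite Hk; apply Rinv_0_lt_compat; lra).
assert (Hw := localized_gap_ge k x0 x y (Rlt_le _ _ Hk0)).
assert (Hw' := localized_gap_ge k x0 x' y' (Rlt_le _ _ Hk0)).
unfold barrier; rewrite <- Rmult_minus_distr_l, Rabs_mult.
assert (Htb : 0 < t / b) by (apply Rdiv_lt_0_compat; lra).
rewrite Rabs_pos_eq by lra.
assert (HD : Rabs (localized_gap k x0 x y - localized_gap k x0 x' y')
    <= 2 * (Rabs (x - x') + Rabs (y - y')))
  by (apply localized_gap_lipschitz with r; auto; apply Rabs_le; lra).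
assert (HE : exp (G / t) <= exp (G / t0)).
{ destruct (Req_dec (G / t) (G / t0)) as [->|Hne]; [lra|].
  apply Rlt_le, exp_increasing.
  assert (G / t <= G / t0); [|lra].
  apply Rmult_le_compat_l; [assumption|apply Rinv_le_contravar; lra]. }
replace (2 * (t1 / b * exp (G / t0)) * (Rabs (x - x') + Rabs (y - y')))
  with (t1 / b * (exp (G / t0) * (2 * (Rabs (x - x') + Rabs (y - y'))))) by ring.
apply Rmult_le_compat; [lra|apply Rabs_pos| |].
- apply Rmult_le_compat_r; [apply Rlt_le, Rinv_0_lt_compat|]; lra.
- eapply Rle_trans; [apply ln_1_plus_lipschitz; [apply exp_pos|lra|lra]|].
  apply Rmult_le_compat; [apply Rlt_le, exp_pos|apply Rabs_pos|assumption|assumption].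
Qed.

(** * Comparison with the barrier and the one-sided slope bound *)

Section TwoPointComparison.
Variables (M A P r L T : R) (Om : R -> Prop) (v p : R -> R -> R) (x0 t1 : R).
Hypothesis (HM : 0 < M) (HA : 0 < A) (HP : 0 < P) (Hr : 0 < r) (HL : 0 <= L)
  (HOm : forall y, x0 - r <= y <= x0 + r -> Om y)
  (Hsol : steep_solution A P T Om v p)
  (Hp : forall y s, Om y -> 0 < s <= T -> Rabs (p y s) <= L)
  (Hosc : forall x y s, Om x -> Om y -> 0 < s <= T -> v y s - v x s <= M)
  (Ht1 : 0 < t1 <= T)
  (Hsmall1 : t1 <= 3 * M / A * M ^ 2 / (8 * P))
  (Hsmall2 : t1 <= 3 * M / A * M * r / 4).
Let b := 3 * M / A.
Let k := / (4 * r).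

Lemma no_interior_touching (x y t t0 : R) :
  0 < t0 < t -> t <= t1 -> x0 - r < x < y -> y < x0 + r ->
  barrier b (2 * b * M) k x0 x y t <= M ->
  ~ (forall x' y' t', x0 - r <= x' <= y' -> y' <= x0 + r -> t0 <= t' <= t1 ->
      v y' t' - v x' t' - barrier b (2 * b * M) k x0 x' y' t'
        <= v y t - v x t - barrier b (2 * b * M) k x0 x y t).
Proof.
intros Ht0 Ht Hx Hy HbM Hmax.
assert (Hb : 0 < b) by (apply Rdiv_lt_0_compat; lra).
assert (Hk : 0 < k) by (apply Rinv_0_lt_compat; lra).
assert (Hkr : k * r = 1 / 4) by (unfold k; field; lra).
assert (HbA : b * A = 3 * M) by (unfold b; field; lra).
assert (Hsep : forall x y, x <= y -> 0 <= localized_gap k x0 x y).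
{ intros x' y' H; generalize (localized_gap_ge k x0 x' y' (Rlt_le _ _ Hk)); lra. }
assert (Hw : 0 <= localized_gap k x0 x y) by (apply Hsep; lra).
set (G := 2 * b * M) in *.
assert (HF := steepness_lower b M k x0 x y t Hb ltac:(lra) Hw HbM).
fold G in HF; set (F := steepness G (localized_gap k x0 x y) t) in *.
assert (Hz : 0 < b * M / t).
{ apply Rdiv_lt_0_compat; [apply Rmult_lt_0_compat|]; lra. }
(* [Hsmall2] gives b M / t >= 4 / r = 16 k. *)
assert (HF1 : 16 * k <= F).
{ apply Rle_trans with (b * M / t); [|generalize (exp_ineq1_le (b * M / t)); lra].
  apply Rmult_le_reg_r with t; [lra|].
  replace (b * M / t * t) with (b * M) by (field; lra).
  apply Rle_trans with (16 * k * (b * M * r / 4)).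
  - apply Rmult_le_compat_l; [lra|]; unfold b; lra.
  - right; unfold k; field; lra. }
(* [Hsmall1] gives b M ^ 2 / (8 t) >= P; the factor 1 / 2 allows for the smallest slope of the
   gap. *)
assert (HF2 : P <= t / b * (1 / 2 * F)).
{ apply Rle_trans with (t / b * (1 / 2 * (b * M / t / 2) ^ 2)).
  - replace (t / b * (1 / 2 * (b * M / t / 2) ^ 2)) with (b * M ^ 2 / 8 / t)
      by (field; lra).
    apply Rmult_le_reg_r with t; [lra|].
    replace (b * M ^ 2 / 8 / t * t) with (P * (b * M ^ 2 / (8 * P))) by (field; lra).
    apply Rmult_le_compat_l; [lra|]; unfold b; lra.
  - apply Rmult_le_compat_l; [apply Rlt_le, Rdiv_lt_0_compat; lra|].
    generalize (exp_ge_square (b * M / t)); lra. }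
assert (Hm : forall z, Rabs (z - x0) <= r ->
  1 / 2 <= 1 + 2 * k * (z - x0) /\ 1 / 2 <= 1 - 2 * k * (z - x0)).
{ intros z Hz'; apply Rabs_le_between in Hz'.
  assert (- (k * r) <= k * (z - x0) <= k * r); [|lra].
  split; [rewrite <- Ropp_mult_distr_r_reverse|]; apply Rmult_le_compat_l; lra. }
assert (HFm : forall m, 1 / 2 <= m -> P <= t / b * (m * F)).
{ intros m Hm'; eapply Rle_trans; [exact HF2|].
  apply Rmult_le_compat_l; [apply Rlt_le, Rdiv_lt_0_compat; lra|].
  apply Rmult_le_compat_r; lra. }
destruct (Hm x) as [_ Hmx]; [apply Rabs_le; lra|].
destruct (Hm y) as [Hmy _]; [apply Rabs_le; lra|].
destruct (Hsol x t) as [_ [c1 [vt1 [vxx1 [Hc1 [HA1 [Hdt1 [Hdx1 ->]]]]]]]];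
  [apply HOm; lra|lra|].
destruct (Hsol y t) as [_ [c2 [vt2 [vxx2 [Hc2 [HA2 [Hdt2 [Hdx2 ->]]]]]]]];
  [apply HOm; lra|lra|].
assert (Htime : 1 / b * ln (1 + localized_gap k x0 x y * exp (G / t))
    - G / (b * t) * (localized_gap k x0 x y * F) <= c2 * vxx2 - c1 * vxx1).
{ apply (last_time_max_derive (fun s => 0 <= s <= T) (v y) (v x)
    (fun s => barrier b G k x0 x y s) t0 t); try assumption; try lra.
  - intros s Hs; lra.
  - apply barrier_dt; [assumption|lra|assumption].
  - intros s Hs; apply Hmax; lra. }
assert (Hlow := barrier_dt_lower b G (localized_gap k x0 x y) t Hb ltac:(lra)
  ltac:(apply Rmult_le_pos; lra) Hw).
fold F in Hlow.
assert (HG : G / (b * t) = 2 * M / t) by (unfold G; field; lra).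
(* Maximum in [y] with [x] and [t] fixed, on a neighbourhood so small that the pair stays in the
   triangle; then the same in [x]. *)
destruct (local_max_derivatives
  (fun z => v z t - v x t - barrier b G k x0 x z t)
  (fun z => p z t - t / b * ((1 + 2 * k * (z - x0)) * steepness G (localized_gap k x0 x z) t))
  y (vxx2 - t / b * (2 * k * F - ((1 + 2 * k * (y - x0)) * F) ^ 2))
  (Rmin (y - x) (x0 + r - y))) as [Hy1 Hy2].
{ apply Rmin_glb_lt; lra. }
{ intros z Hz'; apply Rabs_lt_between in Hz'.
  generalize (Rmin_l (y - x) (x0 + r - y)) (Rmin_r (y - x) (x0 + r - y)); intros.
  apply (is_derive_minus (fun z => v z t - v x t) (fun z => barrier b G k x0 x z t)).
  - replace (p z t) with (p z t - 0) by ring.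
    apply (is_derive_minus (fun z => v z t) (fun _ => v x t)).
    + apply Hsol; [apply HOm; lra|lra].
    + apply (is_derive_const (v x t)).
  - apply barrier_dy; [assumption|apply Hsep; lra]. }
{ apply (is_derive_minus (fun z => p z t)); [exact Hdx2|].
  apply barrier_dyy; assumption. }
{ intros z Hz'; apply Rabs_lt_between in Hz'.
  generalize (Rmin_l (y - x) (x0 + r - y)) (Rmin_r (y - x) (x0 + r - y)); intros.
  apply Hmax; lra. }
destruct (local_max_derivatives
  (fun z => v y t - v z t - barrier b G k x0 z y t)
  (fun z => - p z t - - (t / b * ((1 - 2 * k * (z - x0)) * steepness G (localized_gap k x0 z y) t)))
  x (- vxx1 - t / b * (2 * k * F - ((1 - 2 * k * (x - x0)) * F) ^ 2))
  (Rmin (y - x) (x - (x0 - r)))) as [Hx1 Hx2].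
{ apply Rmin_glb_lt; lra. }
{ intros z Hz'; apply Rabs_lt_between in Hz'.
  generalize (Rmin_l (y - x) (x - (x0 - r))) (Rmin_r (y - x) (x - (x0 - r))); intros.
  apply (is_derive_minus (fun z => v y t - v z t) (fun z => barrier b G k x0 z y t)).
  - replace (- p z t) with (0 - p z t) by ring.
    apply (is_derive_minus (fun _ => v y t) (fun z => v z t)).
    + apply (is_derive_const (v y t)).
    + apply Hsol; [apply HOm; lra|lra].
  - apply barrier_dx; [assumption|apply Hsep; lra]. }
{ apply (is_derive_minus (fun z => - p z t)).
  - apply (is_derive_opp (fun z => p z t)); exact Hdx1.
  - apply barrier_dxx; assumption. }
{ intros z Hz'; apply Rabs_lt_between in Hz'.
  generalize (Rmin_l (y - x) (x - (x0 - r))) (Rmin_r (y - x) (x - (x0 - r))); intros.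
  apply Hmax; lra. }
fold F in Hy1, Hx1.
assert (Hcy := barrier_concavity b t k _ F Hb ltac:(lra) (Rlt_le _ _ Hk) Hmy HF1).
assert (Hcx := barrier_concavity b t k _ F Hb ltac:(lra) (Rlt_le _ _ Hk) Hmx HF1).
assert (Hpy : p y t = t / b * ((1 + 2 * k * (y - x0)) * F)) by lra.
assert (Hpx : p x t = t / b * ((1 - 2 * k * (x - x0)) * F)) by lra.
rewrite <- Hpy in Hcy; rewrite <- Hpx in Hcx.
assert (Hdy : c2 * vxx2 <= - (b / (2 * t)) * A).
{ apply diffusion_upper with P (p y t); try lra; try assumption.
  rewrite Rabs_pos_eq; rewrite Hpy; [apply HFm; assumption|].
  generalize (HFm _ Hmy); lra. }
assert (Hdx : c1 * - vxx1 <= - (b / (2 * t)) * A).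
{ apply diffusion_upper with P (p x t); try lra; try assumption.
  rewrite Rabs_pos_eq; rewrite Hpx; [apply HFm; assumption|].
  generalize (HFm _ Hmx); lra. }
(* The 3 in [b] is chosen for this: b A = 3 M, so both variables together give - 3 M / t, strictly
   below the - 2 M / t forced by the time derivative. *)
assert (Hgain : - (b / (2 * t)) * A + - (b / (2 * t)) * A = - (3 * M / t)).
{ rewrite <- HbA; field; lra. }
assert (0 < M / t) by (apply Rdiv_lt_0_compat; lra).
lra.
Qed.

(** At [t0], wherever the barrier is below M, its slope in the gap is at least b M ^ 2 / (4 t0),
    which dominates [L] by assumption. The barrier itself does not involve [t0]. *)
Lemma two_point_estimate (t0 x y t : R) :
  0 < t0 <= t1 -> 4 * L * t0 <= b * M ^ 2 -> t0 <= t <= t1 ->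
  x0 - r <= x <= y -> y <= x0 + r ->
  v y t - v x t <= barrier b (2 * b * M) k x0 x y t.
Proof.
intros Ht0 HLt Ht Hx Hy.
assert (Hb : 0 < b) by (apply Rdiv_lt_0_compat; lra).
assert (Hk : 0 < k) by (apply Rinv_0_lt_compat; lra).
assert (HbM : 0 < b * M) by (apply Rmult_lt_0_compat; assumption).
assert (HvL : forall s, 0 < s <= T -> forall x y, x0 - r <= x <= x0 + r ->
  x0 - r <= y <= x0 + r -> Rabs (v x s - v y s) <= L * Rabs (x - y)).
{ intros s Hs; apply bounded_derive_lipschitz with (fun z => p z s).
  - intros c Hc; apply Hsol; [apply HOm; assumption|assumption].
  - intros c Hc; apply Hp; [apply HOm; assumption|assumption]. }
destruct (triangle_cylinder_max
  (fun x y t => v y t - v x t - barrier b (2 * b * M) k x0 x y t)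
  (x0 - r) (x0 + r) t0 t1 (L + 2 * (t1 / b * exp (2 * b * M / t0))))
  as [x' [y' [t' [Hx' [Hy' [Ht' Hmax]]]]]]; try lra.
{ assert (0 < t1 / b * exp (2 * b * M / t0)); [|lra].
  apply Rmult_lt_0_compat; [apply Rdiv_lt_0_compat; lra|apply exp_pos]. }
{ intros x1 y1 x2 y2 s H1 H2 H3 H4 Hs.
  assert (Hb' := barrier_lipschitz b (2 * b * M) k r x0 x1 y1 x2 y2 s t0 t1
    Hb ltac:(lra) Hr eq_refl ltac:(lra) ltac:(lra) H1 H2 H3 H4).
  assert (Hvx := HvL s ltac:(lra) x1 x2 ltac:(lra) ltac:(lra)).
  assert (Hvy := HvL s ltac:(lra) y1 y2 ltac:(lra) ltac:(lra)).
  apply Rabs_le_between in Hb'; apply Rabs_le_between in Hvx;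
    apply Rabs_le_between in Hvy.
  apply Rabs_le; split; lra. }
{ intros x1 y1 H1 H2.
  assert (HT : forall s, t0 <= s <= t1 -> 0 <= s <= T) by (intros s Hs; lra).
  assert (Hv : forall z, Om z -> continuity (fun s => v z (clamp t0 t1 s))).
  { intros z Hz; apply (is_derive_within_continuity (fun s => 0 <= s <= T) (v z));
      [lra|assumption|].
    intros s Hs; destruct (Hsol z s Hz) as [_ [c [vt [vxx [_ [_ [Hdt _]]]]]]]; [lra|].
    exists vt; exact Hdt. }
  apply (continuity_minus (fun s => v y1 (clamp t0 t1 s) - v x1 (clamp t0 t1 s))
    (fun s => barrier b (2 * b * M) k x0 x1 y1 (clamp t0 t1 s))).
  - apply (continuity_minus (fun s => v y1 (clamp t0 t1 s)) (fun s => v x1 (clamp t0 t1 s)));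
      apply Hv, HOm; lra.
  - apply (is_derive_within_continuity (fun s => 0 <= s <= T)
      (barrier b (2 * b * M) k x0 x1 y1)); [lra|assumption|].
    intros s Hs; eexists; apply is_derive_is_derive_within, barrier_dt;
      [assumption|lra|].
    generalize (localized_gap_ge k x0 x1 y1 (Rlt_le _ _ Hk)); lra. }
(* Otherwise the maximum is positive and lies where the barrier is below M; the diagonal, the sides
   and the time [t0] are then excluded in turn. *)
apply Rnot_lt_le; intros Hlt.
assert (Hpos : 0 < v y' t' - v x' t' - barrier b (2 * b * M) k x0 x' y' t').
{ generalize (Hmax x y t Hx Hy Ht); lra. }
assert (Hsep := localized_gap_ge k x0 x' y' (Rlt_le _ _ Hk)).
assert (HltM : barrier b (2 * b * M) k x0 x' y' t' < M).
{ assert (v y' t' - v x' t' <= M) by (apply Hosc; [apply HOm|apply HOm|]; lra).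
  lra. }
assert (Hxy : x' < y').
{ destruct (Req_dec x' y') as [<-|Hne]; [|lra].
  generalize (barrier_ge_0 b (2 * b * M) k x0 x' x' t' Hb); lra. }
(* By [Hsmall2] a gap of at least r / 4 would raise the barrier to M, and on either side the gap is
   at least k r ^ 2 = r / 4. *)
assert (Hnear : localized_gap k x0 x' y' < r / 4).
{ apply Rnot_le_lt; intros Hfar.
  assert (M <= barrier b (2 * b * M) k x0 x' y' t'); [|lra].
  apply barrier_far; try lra.
  apply Rle_trans with (b * M * (r / 4)); [unfold b; lra|].
  apply Rmult_le_compat_l; lra. }
assert (Hkr : k * r ^ 2 = r / 4) by (unfold k; field; lra).
assert (Hx'' : x0 - r < x').
{ destruct (Req_dec x' (x0 - r)) as [He|Hne]; [|lra].
  unfold localized_gap in Hnear; rewrite He in Hnear at 2.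
  replace (x0 - r - x0) with (- r) in Hnear by ring.
  generalize (Rmult_le_pos _ _ (Rlt_le _ _ Hk) (pow2_ge_0 (y' - x0))).
  replace ((- r) ^ 2) with (r ^ 2) in Hnear by ring; lra. }
assert (Hy'' : y' < x0 + r).
{ destruct (Req_dec y' (x0 + r)) as [He|Hne]; [|lra].
  unfold localized_gap in Hnear; rewrite He in Hnear at 2.
  replace (x0 + r - x0) with r in Hnear by ring.
  generalize (Rmult_le_pos _ _ (Rlt_le _ _ Hk) (pow2_ge_0 (x' - x0))); lra. }
destruct (Req_dec t' t0) as [He|Hne].
(* The barrier is at least the gap times its slope, hence at least L (y' - x'), contradicting
   positivity. *)
- subst t'.
  assert (HF := steepness_lower b M k x0 x' y' t0 Hb ltac:(lra) ltac:(lra) ltac:(lra)).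
  assert (Hge := barrier_ge_steepness b (2 * b * M) k x0 x' y' t0 Hb ltac:(lra) ltac:(lra)).
  assert (Hsq := exp_ge_square (b * M / t0) ltac:(apply Rdiv_le_0_compat; lra)).
  assert (HvL' := HvL t0 ltac:(lra) y' x' ltac:(lra) ltac:(lra)).
  rewrite (Rabs_pos_eq (y' - x')) in HvL' by lra; apply Rabs_le_between in HvL'.
  set (w := localized_gap k x0 x' y') in *.
  assert (HLw : L * w <= t0 / b * (w * (b * M / t0 / 2) ^ 2)).
  { replace (t0 / b * (w * (b * M / t0 / 2) ^ 2)) with (b * M ^ 2 / (4 * t0) * w)
      by (field; lra).
    apply Rmult_le_compat_r; [lra|].
    apply Rmult_le_reg_r with (4 * t0); [lra|].
    replace (b * M ^ 2 / (4 * t0) * (4 * t0)) with (b * M ^ 2) by (field; lra); lra. }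
  assert (t0 / b * (w * (b * M / t0 / 2) ^ 2)
    <= t0 / b * (w * steepness (2 * b * M) w t0)).
  { apply Rmult_le_compat_l; [apply Rlt_le, Rdiv_lt_0_compat; lra|].
    apply Rmult_le_compat_l; lra. }
  assert (L * (y' - x') <= L * w) by (apply Rmult_le_compat_l; lra).
  lra.
- apply (no_interior_touching x' y' t' t0); try lra.
  exact Hmax.
Qed.

(** In [two_point_estimate] with x = x0 both sides vanish at y = x0, so their right derivatives
    there are ordered. *)
Lemma slope_upper_bound : p x0 t1 <= t1 / b * exp (2 * b * M / t1).
Proof.
assert (Hb : 0 < b) by (apply Rdiv_lt_0_compat; lra).
assert (Hk : 0 < k) by (apply Rinv_0_lt_compat; lra).
assert (HbM : 0 < b * M ^ 2) by (apply Rmult_lt_0_compat; [|apply pow_lt]; assumption).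
(* L + 1 keeps the denominator positive when L = 0. *)
set (t0 := Rmin t1 (b * M ^ 2 / (4 * (L + 1)))).
assert (Ht0 : 0 < t0 <= t1).
{ split; [|apply Rmin_l].
  apply Rmin_glb_lt; [|apply Rdiv_lt_0_compat]; lra. }
assert (HLt : 4 * L * t0 <= b * M ^ 2).
{ apply Rle_trans with (4 * (L + 1) * t0).
  - apply Rmult_le_compat_r; lra.
  - apply Rle_trans with (4 * (L + 1) * (b * M ^ 2 / (4 * (L + 1)))).
    + apply Rmult_le_compat_l; [lra|apply Rmin_r].
    + right; field; lra. }
assert (Hw : localized_gap k x0 x0 x0 = 0) by (unfold localized_gap; ring).
assert (Hd : is_derive (fun y => barrier b (2 * b * M) k x0 x0 y t1 - v y t1) x0
  (t1 / b * exp (2 * b * M / t1) - p x0 t1)).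
{ apply (is_derive_minus (fun y => barrier b (2 * b * M) k x0 x0 y t1)).
  - replace (t1 / b * exp (2 * b * M / t1)) with
      (t1 / b * ((1 + 2 * k * (x0 - x0)) * steepness (2 * b * M) (localized_gap k x0 x0 x0) t1)).
    + apply barrier_dy; lra.
    + rewrite Hw; unfold steepness; field; lra.
  - apply Hsol; [apply HOm; lra|lra]. }
apply (right_min_derive _ _ _ r Hr) in Hd; [lra|].
intros y Hy.
assert (H := two_point_estimate t0 x0 y t1 Ht0 HLt ltac:(lra) ltac:(lra) ltac:(lra)).
unfold barrier at 1; rewrite Hw, Rmult_0_l, Rplus_0_r, ln_1; lra.
Qed.
End TwoPointComparison.

(** * Reflection, oscillation, gradient bound and domain *)

(** This turns the upper bound on the slope into the lower one; the structure condition sees [p]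
    through its absolute value and its square. *)
Lemma steep_solution_opp (A P T : R) (Om : R -> Prop) (v p : R -> R -> R) :
  steep_solution A P T Om v p ->
  steep_solution A P T Om (fun x t => - v x t) (fun x t => - p x t).
Proof.
intros H y s Hy Hs; destruct (H y s Hy Hs) as [Hdx [c [vt [vxx [Hc [HA [Hdt [Hdxx Heq]]]]]]]].
split; [apply (is_derive_opp (fun z => v z s)); exact Hdx|].
exists c, (- vt), (- vxx); split; [|split; [|split; [|split]]].
- exact Hc.
- rewrite Rabs_Ropp, <- Rsqr_pow2, <- Rsqr_neg, Rsqr_pow2; exact HA.
- apply filterlim_ext with (fun z => opp ((v y z - v y s) / (z - s))).
  { intros z; unfold Rdiv, opp; simpl; ring. }
  eapply filterlim_comp; [exact Hdt|apply (filterlim_opp vt)].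
- apply (is_derive_opp (fun z => p z s) y vxx Hdxx).
- rewrite Heq; ring.
Qed.

Lemma osc_ge_difference (Q : R -> R -> Prop) (f : R -> R -> R) (M x t y s : R) :
  Rbar_le (osc Q f) M -> Q x t -> Q y s -> f y s - f x t <= M.
Proof.
unfold osc, sup_on, inf_on; intros HM Hx Hy.
destruct (Lub_Rbar_correct (fun r => exists x t, Q x t /\ r = f x t)) as [Hub _].
destruct (Glb_Rbar_correct (fun r => exists x t, Q x t /\ r = f x t)) as [Hlb _].
specialize (Hub (f y s) (ex_intro _ y (ex_intro _ s (conj Hy eq_refl)))).
specialize (Hlb (f x t) (ex_intro _ x (ex_intro _ t (conj Hx eq_refl)))).
(* As [Q] is inhabited, an infinite supremum or infimum would make the oscillation [p_infty],
   against [HM]. *)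
destruct (Lub_Rbar _) as [S| |]; destruct (Glb_Rbar _) as [I| |]; simpl in *;
  try contradiction; lra.
Qed.

Lemma Lub_Rbar_nonneg (E : R -> Prop) (r : R) : E r -> 0 <= r -> Rbar_le 0 (Lub_Rbar E).
Proof.
intros Hr H0; apply Rbar_le_trans with (Finite r); [exact H0|].
apply Lub_Rbar_correct; exact Hr.
Qed.

Lemma open_interval_ball (Om : R -> Prop) (x : R) : is_open_interval Om -> Om x ->
  exists e, 0 < e /\ forall y, Rabs (y - x) < e -> Om y.
Proof.
intros [l [r [_ HOm]]] Hx; apply HOm in Hx; destruct Hx as [Hl Hr].
destruct (open_Rbar_lt' x r Hr) as [d1 H1].
destruct (open_Rbar_gt' x l Hl) as [d2 H2].
exists (Rmin d1 d2); split; [apply Rmin_pos; apply cond_pos|].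
intros y Hy; apply HOm; split.
- apply H2; eapply Rlt_le_trans; [exact Hy|apply Rmin_r].
- apply H1; eapply Rlt_le_trans; [exact Hy|apply Rmin_l].
Qed.

(** In [Rbar] opposite infinities add up to 0, so every summand of the norm is shown nonnegative
    before finiteness passes to one of them. The point [x'] supplies a pair for the seminorm, since
    the supremum of an empty set is [m_infty]. *)
Lemma in_H2_bounded_dx (Om : R -> Prop) (T x x' : R) (u : R -> R -> R) :
  0 <= T -> Om x -> Om x' -> x <> x' -> is_open_interval Om -> in_H2 Om T u ->
  exists L, 0 <= L /\ forall y s, Om y -> 0 <= s <= T -> Rabs (dx u y s) <= L.
Proof.
intros HT Hx Hx' Hne HOm [D [[HD0 [_ HDx]] Hfin]].
assert (HQ : cylinder Om T x 0) by (split; [assumption|lra]).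
assert (HQ' : cylinder Om T x' 0) by (split; [assumption|lra]).
assert (Hdx : forall y s, Om y -> 0 <= s <= T -> dx u y s = D 1%nat 0%nat y s).
{ intros y s Hy Hs; apply is_derive_unique.
  apply is_derive_ext_loc with (fun z => D 0%nat 0%nat z s).
  - destruct (open_interval_ball Om y HOm Hy) as [e [He Hball]].
    exists (mkposreal e He); intros z Hz; apply HD0; split; [apply Hball, Hz|assumption].
  - apply (HDx 0%nat 0%nat y s); [apply le_n|split; assumption]. }
unfold holder_norm, parabolic_indices in Hfin; simpl in Hfin.
set (S0 := sup_on _ (fun x t => Rabs (D 0%nat 0%nat x t))) in Hfin.
set (S1 := sup_on _ (fun x t => Rabs (D 1%nat 0%nat x t))) in Hfin.
set (N := holder_seminorm _ _ _) in Hfin.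
assert (H0 : Rbar_le 0 S0).
{ apply Lub_Rbar_nonneg with (Rabs (D 0%nat 0%nat x 0)); [|apply Rabs_pos].
  exists x, 0; auto. }
assert (H1 : Rbar_le 0 S1).
{ apply Lub_Rbar_nonneg with (Rabs (D 1%nat 0%nat x 0)); [|apply Rabs_pos].
  exists x, 0; auto. }
assert (HN : Rbar_le 0 N).
{ apply Lub_Rbar_nonneg with (Rabs (D 1%nat 0%nat x 0 - D 1%nat 0%nat x' 0)
    / Rpower (Rabs (x - x') + sqrt (Rabs (0 - 0))) 1).
  - exists x, 0, x', 0; repeat split; auto; try lra.
    intros H; apply Hne; congruence.
  - apply Rdiv_le_0_compat; [apply Rabs_pos|apply exp_pos]. }
assert (Hle : forall y s, Om y -> 0 <= s <= T -> Rbar_le (Rabs (dx u y s)) S1).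
{ intros y s Hy Hs; apply Lub_Rbar_correct; exists y, s.
  split; [split; assumption|rewrite Hdx by assumption; reflexivity]. }
clearbody S0 S1 N.
destruct S0; destruct S1 as [L| |]; destruct N; simpl in *; try contradiction;
  try discriminate; exists L; split; assumption.
Qed.

Lemma dist_boundary_pos (Om : R -> Prop) (x : R) : is_open_interval Om -> Om x ->
  Rbar_lt 0 (dist_boundary Om x).
Proof.
intros HOm Hx; destruct (open_interval_ball Om x HOm Hx) as [e [He Hball]].
apply Rbar_lt_le_trans with (Finite e); [exact He|].
apply Glb_Rbar_correct; intros r [y [Hy ->]]; simpl.
apply Rnot_lt_le; intros Hlt.
assert (He' : 0 < e - Rabs (x - y)) by lra.
destruct (Hy (mkposreal _ He')) as [_ [z [Hz1 Hz2]]].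
apply Hz2, Hball.
change (Rabs (z - y) < e - Rabs (x - y)) in Hz1.
generalize (Rabs_triang (z - y) (y - x)); rewrite (Rabs_minus_sym y x).
replace (z - y + (y - x)) with (z - x) by ring; lra.
Qed.

(** A finite endpoint is a boundary point, hence at distance more than [r] from [x]; an infinite
    endpoint imposes no restriction. *)
Lemma ball_in_open_interval (Om : R -> Prop) (x r y : R) : is_open_interval Om -> Om x ->
  0 < r -> Rbar_lt r (dist_boundary Om x) -> x - r <= y <= x + r -> Om y.
Proof.
intros [l [b [_ HOm]]] Hx Hr Hd Hy.
assert (Hbd : forall z, boundary Om z -> r < Rabs (x - z)).
{ intros z Hz.
  assert (H : Rbar_le (dist_boundary Om x) (Rabs (x - z))).
  { apply Glb_Rbar_correct; exists z; auto. }
  exact (Rbar_lt_le_trans _ _ _ Hd H). }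
assert (Hx' := proj1 (HOm x) Hx); destruct Hx' as [Hl Hb].
assert (Hin : forall z w eps, Rabs (z - w) < eps -> ball w eps z).
{ intros z w eps H; exact H. }
apply HOm; split.
- destruct l as [l| |]; simpl in *; try contradiction; auto.
  assert (H : r < Rabs (x - l)); [|rewrite Rabs_pos_eq in H by lra; lra].
  apply Hbd; intros eps; split.
  (* The minimum with [x] keeps this point near [l] below the right endpoint. *)
  + exists (Rmin x (l + eps / 2)); split.
    * apply Hin, Rabs_lt_between; generalize (cond_pos eps) (Rmin_r x (l + eps / 2)).
      unfold Rmin; destruct (Rle_dec _ _); lra.
    * apply HOm; split; simpl.
      -- generalize (cond_pos eps); intros; apply Rmin_glb_lt; lra.
      -- generalize (Rmin_l x (l + eps / 2)); destruct b; simpl in *; lra.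
  + exists l; split; [apply ball_center|].
    intros Hc; apply HOm in Hc; simpl in Hc; lra.
- destruct b as [b| |]; simpl in *; try contradiction; auto.
  assert (H : r < Rabs (x - b)); [|rewrite Rabs_left in H by lra; lra].
  apply Hbd; intros eps; split.
  + exists (Rmax x (b - eps / 2)); split.
    * apply Hin, Rabs_lt_between; generalize (cond_pos eps).
      unfold Rmax; destruct (Rle_dec _ _); lra.
    * apply HOm; split; simpl.
      -- generalize (Rmax_l x (b - eps / 2)); destruct l; simpl in *; lra.
      -- generalize (cond_pos eps); intros; apply Rmax_lub_lt; lra.
  + exists b; split; [apply ball_center|].
    intros Hc; apply HOm in Hc; simpl in Hc; lra.
Qed.

(** * Choice of the constants and conclusion *)

Theorem theorem3p4 :
  forall (M A P : R) (d : Rbar), 0 < M -> 0 < A -> 0 < P ->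
  exists T' C1 C2 : R, 0 < T' /\
  forall (Om : R -> Prop) (T : R) (a : R -> R -> R -> R -> R)
    (u : R -> R -> R) (x : R),
    is_open_interval Om -> 0 < T ->
    (forall p q y s, Om y -> 0 <= s <= T -> 0 < a p q y s) ->
    (forall p q y s, P <= Rabs p -> Om y -> 0 <= s <= T ->
       A <= a p q y s * p ^ 2) ->
    in_H2 Om T u ->
    classical_solution Om T a u ->
    Rbar_le (osc (cylinder Om T) u) M ->
    Om x -> dist_boundary Om x = d ->
    forall t : R, 0 < t < T' -> t <= T ->
      Rabs (dx u x t) <= C1 * sqrt t * (1 + t) * exp (C2 / t).
Proof.
intros M A P d HM HA HP.
(* The radius is fixed from [d] alone, before the interval is known. The value 1 serves for an empty
   boundary, and as a default when d <= 0, which cannot occur for a point of an open interval. *)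
assert (Hr : exists r, 0 < r /\ (Rbar_lt 0 d -> Rbar_lt r d)).
{ destruct d as [d| |].
  - destruct (Rlt_dec 0 d) as [Hd|Hd].
    + exists (d / 2); simpl; lra.
    + exists 1; split; [lra|intros H; contradiction].
  - exists 1; split; [lra|intros _; exact I].
  - exists 1; split; [lra|intros H; contradiction]. }
destruct Hr as [r [Hr Hrd]].
set (b := 3 * M / A).
assert (Hb : 0 < b) by (apply Rdiv_lt_0_compat; lra).
(* The two terms of the minimum yield [Hsmall1] and [Hsmall2]; the distance enters T' alone, through
   [r]. *)
exists (Rmin (b * M ^ 2 / (8 * P)) (b * M * r / 4)), (1 / b), (2 * b * M); split.
{ apply Rmin_glb_lt.
  - apply Rdiv_lt_0_compat; [|lra].
    apply Rmult_lt_0_compat; [|apply pow_lt]; assumption.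
  - apply Rdiv_lt_0_compat; [|lra].
    apply Rmult_lt_0_compat; [apply Rmult_lt_0_compat|]; assumption. }
intros Om T a u x HOm HT Ha HaA HH2 Hsol Hosc Hx Hd t [Ht Ht'] HtT.
assert (Hball : forall y, x - r <= y <= x + r -> Om y).
{ intros y; apply ball_in_open_interval; auto.
  rewrite Hd; apply Hrd; rewrite <- Hd; apply dist_boundary_pos; assumption. }
destruct (in_H2_bounded_dx Om T x (x + r) u) as [L [HL Hdx]]; auto; try lra.
{ apply Hball; lra. }
assert (Hsteep : steep_solution A P T Om u (dx u)).
{ intros y s Hy Hs; destruct (Hsol y s Hy Hs) as [Hex [ut [uxx [Hut [Huxx Heq]]]]].
  split; [apply Derive_correct, Hex|].
  exists (a (dx u y s) (u y s) y s), ut, uxx; split; [|split; [|split; [|split]]]; try assumption.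
  - apply Ha; [assumption|lra].
  - intros Hp; apply HaA; [assumption|assumption|lra]. }
assert (Ht1 := Rmin_l (b * M ^ 2 / (8 * P)) (b * M * r / 4)).
assert (Ht2 := Rmin_r (b * M ^ 2 / (8 * P)) (b * M * r / 4)).
assert (Hup : dx u x t <= t / b * exp (2 * b * M / t)).
{ apply (slope_upper_bound M A P r L T Om u (dx u)); auto; try (fold b; lra).
  - intros y s Hy Hs; apply Hdx; [assumption|lra].
  - intros y z s Hy Hz Hs; apply (osc_ge_difference _ _ _ _ _ _ _ Hosc); split; auto; lra. }
assert (Hlow : - dx u x t <= t / b * exp (2 * b * M / t)).
{ apply (slope_upper_bound M A P r L T Om (fun x t => - u x t) (fun x t => - dx u x t));
    auto; try (fold b; lra).
  - apply steep_solution_opp; assumption.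
  - intros y s Hy Hs; rewrite Rabs_Ropp; apply Hdx; [assumption|lra].
  - intros y z s Hy Hz Hs; replace (- u z s - - u y s) with (u y s - u z s) by ring.
    apply (osc_ge_difference _ _ _ _ _ _ _ Hosc); split; auto; lra. }
(* The bound obtained has the prefactor t / b, and t <= sqrt t (1 + t) because sqrt t <= 1 + t. *)
apply Rle_trans with (t / b * exp (2 * b * M / t)); [apply Rabs_le; lra|].
apply Rmult_le_compat_r; [apply Rlt_le, exp_pos|].
replace (t / b) with (1 / b * t) by (field; lra).
rewrite Rmult_assoc; apply Rmult_le_compat_l; [apply Rlt_le, Rdiv_lt_0_compat; lra|].
rewrite <- (sqrt_sqrt t) at 1 by lra.
apply Rmult_le_compat_l; [apply sqrt_pos|].
rewrite <- (sqrt_sqrt t) at 2 by lra.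
generalize (sqrt_pos t); nra.
Qed.
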